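(* Turing equivalence $\equiv_T$ on $2^\omega$ is not learnable. In fact, $\equiv_T$ is not $\boldsymbol{\Pi}^0_3$ as a subset of $2^\omega\times 2^\omega$.
   Context: An equivalence relation $E$ on $2^\omega$ is learnable if there are continuous functions $l_n:(2^\omega)^\omega\times 2^\omega\to\omega$ ($\omega$ discrete) such that for all $x$ and $\vec x=(x_i)_{i\in\omega}$, if $x\mathrel{E}x_i$ for some $i$, then $L=\lim_n l_n(\vec x,x)$ exists and $x\mathrel{E}x_L$. *)

(* Defs.v *)
From mathcomp Require Import all_boot.
From mathcomp Require Import classical_sets functions topology cantor.

Set Implicit Arguments.
Unset Strict Implicit.
Unset Printing Implicit Defensive.

Local Open Scope classical_set_scope.

(* The finite levels of the boldface Borel hierarchy. Levels are counted from 1;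
   no set is in Sigma0 0. A countable union of Pi^0_n sets is written as a union
   of sets whose complements are Sigma^0_n. *)
Fixpoint Sigma0 {T : topologicalType} (n : nat) : set (set T) :=
  match n with
  | 0 => set0
  | 1 => open
  | m.+1 => [set A | exists2 F : nat -> set T,
               forall i, Sigma0 m (~` F i) & A = \bigcup_i F i]
  end.

Definition Pi0 {T : topologicalType} (n : nat) : set (set T) :=
  [set A | Sigma0 n (~` A)].

(* Kleene's schemes for the n-ary partial recursive functions relative to an
   oracle. *)
Inductive oprog : nat -> Type :=
| OZero : oprog 0
| OSucc : oprog 1
| OOracle : oprog 1
| OProj n : 'I_n -> oprog n
| OComp m n : oprog m -> ('I_m -> oprog n) -> oprog n
| ORec n : oprog n -> oprog n.+2 -> oprog n.+1
| OMu n : oprog n.+1 -> oprog n.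

(* [oeval X p v k]: with oracle X, the program p halts on input v with output k.
   - ORec f g is h with h(0, u) = f(u) and h(j+1, u) = g(j, h(j, u), u); the
     sequence s lists the values h(0, u), ..., h(v_0, u);
   - OMu f maps v to the least k with f(k, v) = 0, f(j, v) being defined and
     nonzero for all j < k. *)
Fixpoint oeval (X : nat -> nat) n (p : oprog n) : n.-tuple nat -> nat -> Prop :=
  match p in oprog n return n.-tuple nat -> nat -> Prop with
  | OZero => fun _ k => k = 0
  | OSucc => fun v k => k = (thead v).+1
  | OOracle => fun v k => k = X (thead v)
  | OProj _ i => fun v k => k = tnth v i
  | OComp m _ f g => fun v k => exists2 w : m.-tuple nat,
      forall i, oeval X (g i) v (tnth w i) & oeval X f w k
  | ORec _ f g => fun v k =>
      let u := [tuple of behead v] in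
      exists s : nat -> nat,
        [/\ oeval X f u (s 0),
            forall j, j < thead v ->
              oeval X g [tuple of j :: s j :: u] (s j.+1)
          & k = s (thead v)]
  | OMu _ f => fun v k =>
      oeval X f [tuple of k :: v] 0 /\
      forall j, j < k -> exists m, oeval X f [tuple of j :: v] m.+1
  end.

(* Points of 2^omega are identified with their characteristic functions
   nat -> {0, 1}. *)
Definition char_fun (x : cantor_space) (n : nat) : nat := nat_of_bool (x n).

Definition turing_le (x y : cantor_space) : Prop :=
  exists p : oprog 1, forall n, oeval (char_fun y) p [tuple n] (char_fun x n).

Definition turing_equiv (x y : cantor_space) : Prop :=
  turing_le x y /\ turing_le y x.

(* (2^omega)^omega carries the product topology and nat the discrete one. *)
Definition learnable (E : cantor_space -> cantor_space -> Prop) : Prop :=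
  exists l : nat -> prod_topology (fun _ : nat => cantor_space) * cantor_space -> nat,
    (forall n, continuous (l n)) /\
    forall (xs : nat -> cantor_space) (x : cantor_space),
      (exists i, E x (xs i)) ->
      exists L : nat, l n (xs, x) @[n --> \oo] --> L /\ E x (xs L).

(* Main.v *)
Require Import Defs.
From mathcomp Require Import all_boot.
From mathcomp Require Import classical_sets functions topology cantor.
From mathcomp Require Import zify boolp.

(** Let x be the odd part of y (y with all even entries erased). Then x is
    computable from y, so that x and y are Turing equivalent iff y is computable
    from x; we show that the set S of such y is not an intersection of countably
    many F_sigma sets. Conditions fix finitely many values of y and finitely many
    columns of its odd part. Any condition can be extended so that a given
    program fails to compute y from x, by changing an even entry. It can also be
    extended to lie inside a given F_sigma set containing S: otherwise a free
    column could be used to code y itself, step by step, while y is kept out of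
    the F_sigma set, giving an element of S outside of it. A generic y thus lies
    in the intersection but not in S.

    If l learned Turing equivalence, then for x not computable from any eventually
    zero sequence, x and y would be equivalent iff for every finite list U of
    eventually zero sequences there are an extension V of U and N such that
    l_n(y :: xs, x) = 0 for all n >= N and all xs starting with V. Such xs may
    contain x itself, whence the "if" part; if the right-hand side failed, some
    xs of eventually zero sequences would have l_n(y :: xs, x) <> 0 infinitely
    often. This condition is again an intersection of F_sigma sets. *)

Set Implicit Arguments.
Unset Strict Implicit.
Unset Printing Implicit Defensive.

Local Open Scope classical_set_scope.

(** Dependent choice with an invariant, used below to build sequences of approximations. *)
Lemma invariant_choice T (I : nat -> T -> Prop) (R : nat -> T -> T -> Prop) x0 :
  I 0 x0 -> (forall n x, I n x -> exists2 y, I n.+1 y & R n x y) ->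
  exists2 f : nat -> T, f 0 = x0 & forall n, I n (f n) /\ R n (f n) (f n.+1).
Proof.
move=> I0 step.
have /choice[g gP] : forall nx : nat * T, exists y,
    I nx.1 nx.2 -> I nx.1.+1 y /\ R nx.1 nx.2 y.
  move=> [n x] /=; have [/step[y]|] := pselect (I n x); first by exists y.
  by exists x.
pose f := fix f n := if n is m.+1 then g (m, f m) else x0.
exists f => // n.
have If : I n (f n) by elim: n => // n /(gP (n, f n))[].
by split=> //; have [] := gP (n, f n) If.
Qed.

(** * Oracle computations *)

Lemma oeval_fun X n (p : oprog n) v k k' :
  oeval X p v k -> oeval X p v k' -> k = k'.
Proof.
elim: p v k k' => {n} /=.
- by move=> v k k' -> ->.
- by move=> v k k' -> ->.
- by move=> v k k' -> ->.
- by move=> n i v k k' -> ->.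
- move=> m n f IHf g IHg v k k' [w wP fw] [w' wP' fw'].
  suff eqw : w = w' by apply: IHf fw _; rewrite eqw.
  by apply/eq_from_tnth => i; apply: IHg (wP i) (wP' i).
- move=> n f IHf g IHg v k k' [s [s0 sS ->]] [t [t0 tS ->]].
  suff eqs j : j <= thead v -> s j = t j by apply: eqs.
  elim: j => [_|j IHj lt_j]; first exact: IHf s0 t0.
  by have := tS _ lt_j; rewrite -IHj ?(ltnW lt_j)//; exact: IHg (sS _ lt_j).
- move=> n f IHf v k k' [fk0 ltk] [fk'0 ltk'].
  case: (ltngtP k k') => // [/ltk'|/ltk] [m fm].
    by have := IHf _ _ _ fk0 fm.
  by have := IHf _ _ _ fk'0 fm.
Qed.

Lemma eventually_forall_ltn (P : nat -> nat -> Prop) m :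
  (forall i N N', N <= N' -> P i N -> P i N') ->
  (forall i, i < m -> exists N, P i N) -> exists N, forall i, i < m -> P i N.
Proof.
move=> mono; elim: m => [|m IHm] ex; first by exists 0.
have [i lt_i|N NP] := IHm; first by apply: ex; rewrite ltnS ltnW.
have [N' N'P] := ex m (ltnSn m); exists (maxn N N') => i.
rewrite ltnS leq_eqVlt => /predU1P[->|/NP].
  exact: mono (leq_maxr _ _) N'P.
exact: mono (leq_maxl _ _).
Qed.

(** The use principle: the bounds of the finitely many subcomputations have a maximum. *)
Lemma oeval_use X n (p : oprog n) v k : oeval X p v k ->
  exists N, forall X', (forall i, i < N -> X' i = X i) -> oeval X' p v k.
Proof.
elim: p v k => {n} /=.
- by move=> v k ->; exists 0.
- by move=> v k ->; exists 0.
- by move=> v k ->; exists (thead v).+1 => X' ->.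
- by move=> n i v k ->; exists 0.
- move=> m n f IHf g IHg v k [w wP /IHf[N NP]].
  have [||N' N'P] := @eventually_forall_ltn (fun i N => forall (ltim : i < m) X',
      (forall i, i < N -> X' i = X i) ->
      oeval X' (g (Ordinal ltim)) v (tnth w (Ordinal ltim))) m.
  + by move=> i M M' leM MP ltim X' X'P; apply: MP => j ?; apply: X'P; lia.
  + move=> i ltim; have [M MP] := IHg _ _ _ (wP (Ordinal ltim)).
    by exists M => ltim'; rewrite (bool_irrelevance ltim' ltim).
  exists (maxn N N') => X' X'P; exists w.
    move=> [i ltim]; apply: (N'P i ltim) => j ?; apply: X'P; lia.
  by apply: NP => j ?; apply: X'P; lia.
- move=> n f IHf g IHg v k [s [/IHf[N NP] sS ->]].
  have [||N' N'P] := @eventually_forall_ltn (fun j N => forall X',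
      (forall i, i < N -> X' i = X i) ->
      oeval X' g [tuple of j :: s j :: [tuple of behead v]] (s j.+1)) (thead v).
  + by move=> i M M' leM MP X' X'P; apply: MP => j ?; apply: X'P; lia.
  + by move=> j /sS/IHg.
  exists (maxn N N') => X' X'P; exists s; split=> //.
    by apply: NP => j ?; apply: X'P; lia.
  by move=> j ltj; apply: N'P => // i ?; apply: X'P; lia.
- move=> n f IHf v k [/IHf[N NP] ltk].
  have [||N' N'P] := @eventually_forall_ltn (fun j N => exists m, forall X',
      (forall i, i < N -> X' i = X i) ->
      oeval X' f [tuple of j :: v] m.+1) k.
  + by move=> i M M' leM [m MP]; exists m => X' X'P; apply: MP => j ?; apply: X'P; lia.
  + by move=> j /ltk[m /IHf[M MP]]; exists M, m.
  exists (maxn N N') => X' X'P; split.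
    by apply: NP => j ?; apply: X'P; lia.
  move=> j /N'P[m mP]; exists m; apply: mP => i ?; apply: X'P; lia.
Qed.

(** * Countability of the programs *)

Definition default_oprog n : oprog n :=
  match n with 0 => OZero | _.+1 => OProj ord0 end.

(** Trees labelled by numbers form a countable type. Codes that do not fit the arity [n] fall back
    to [default_oprog]; a label [m.+4.+1] records the intermediate arity [m] of a composition. *)
Fixpoint decode_oprog (t : GenTree.tree nat) : forall n, oprog n :=
  match t with
  | GenTree.Leaf i => fun n =>
      if insub i is Some j then OProj (j : 'I_n) else default_oprog n
  | GenTree.Node c ts =>
      let p i := nth default_oprog (map decode_oprog ts) i in
      match c with
      | 0 => fun n => match n with 0 => OZero | m => default_oprog m end
      | 1 => fun n => match n with 1 => OSucc | m => default_oprog m end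
      | 2 => fun n => match n with 1 => OOracle | m => default_oprog m end
      | 3 => fun n => match n with
                      | 0 => default_oprog 0
                      | n'.+1 => ORec (p 0 n') (p 1 n'.+2)
                      end
      | 4 => fun n => OMu (p 0 n.+1)
      | m.+4.+1 => fun n => OComp (p 0 m) (fun i : 'I_m => p i.+1 n)
      end
  end.

Lemma decode_oprog_surj n (p : oprog n) : exists t, decode_oprog t n = p.
Proof.
elim: p => {n}.
- by exists (GenTree.Node 0 [::]).
- by exists (GenTree.Node 1 [::]).
- by exists (GenTree.Node 2 [::]).
- by move=> n i; exists (GenTree.Leaf (val i)); rewrite /= valK.
- move=> m n f [t tf] g /choice[u ug].
  exists (GenTree.Node m.+4.+1 (t :: map u (enum 'I_m))) => /=.
  rewrite tf; congr OComp; apply: funext => i.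
  by rewrite -map_comp (nth_map i) ?size_enum_ord// nth_ord_enum /= ug.
- move=> n f [t tf] g [u ug].
  by exists (GenTree.Node 3 [:: t; u]); rewrite /= tf ug.
- by move=> n f [t tf]; exists (GenTree.Node 4 [:: t]); rewrite /= tf.
Qed.

(** * Closure properties of relative computability *)

Definition computable_in X n (f : n.-tuple nat -> nat) :=
  exists p : oprog n, forall v, oeval X p v (f v).

Definition computable1_in X (f : nat -> nat) :=
  computable_in X (fun v : 1.-tuple nat => f (thead v)).

Section ComputableIn.
Variable X : nat -> nat.

Lemma computable_proj n (i : 'I_n) : computable_in X (fun v => tnth v i).
Proof. by exists (OProj i). Qed.

Lemma computable1_comp n f (g : n.-tuple nat -> nat) :
  computable1_in X f -> computable_in X g -> computable_in X (fun v => f (g v)).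
Proof.
move=> [p pf] [q qg]; exists (OComp p (fun _ => q)) => v /=.
exists [tuple g v]; last by rewrite -[g v]/(thead [tuple g v]).
by move=> i; rewrite ord1 (tnth_nth 0).
Qed.

Lemma computable_succ : computable1_in X succn.
Proof. by exists OSucc. Qed.

Lemma computable_oracle : computable1_in X X.
Proof. by exists OOracle. Qed.

Lemma computable_const n c : computable_in X (fun _ : n.-tuple nat => c).
Proof.
elim: c => [|c]; last exact: computable1_comp computable_succ.
(* Composition with an empty family of programs raises the arity of [OZero] from 0 to [n]. *)
exists (OComp OZero (fun i : 'I_0 => OMu (OProj ord0))) => v /=.
by exists [tuple] => // -[].
Qed.

Lemma computable_rec n (f : n.-tuple nat -> nat) (g : n.+2.-tuple nat -> nat)
    (h : n.+1.-tuple nat -> nat) :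
  computable_in X f -> computable_in X g ->
  (forall u : n.-tuple nat, h [tuple of 0 :: u] = f u) ->
  (forall j (u : n.-tuple nat), h [tuple of j.+1 :: u] =
     g [tuple of j :: h [tuple of j :: u] :: u]) ->
  computable_in X h.
Proof.
move=> [p pf] [q qg] h0 hS; exists (ORec p q) => v /=.
exists (fun j => h [tuple of j :: [tuple of behead v]]); split.
- by rewrite h0.
- by move=> j _; rewrite hS.
- by congr h; apply: val_inj; case/tupleP: v => a u /=; rewrite theadE.
Qed.

Lemma computable1_rec c (g : nat -> nat) h :
  computable1_in X g -> h 0 = c -> (forall j, h j.+1 = g (h j)) ->
  computable1_in X h.
Proof.
move=> cg h0 hS; apply: (@computable_rec 0 (fun _ => c)
  (fun v => g (tnth v (lift ord0 ord0)))); first exact: computable_const.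
- exact/computable1_comp/computable_proj.
- by [].
- by move=> j u; rewrite theadE (tnth_nth 0) /= hS.
Qed.

Lemma computable_add n (f g : n.-tuple nat -> nat) :
  computable_in X f -> computable_in X g -> computable_in X (fun v => f v + g v).
Proof.
move=> [p pf] [q qg].
have [a aP] : computable_in X
    (fun v : 2.-tuple nat => tnth v ord0 + tnth v (lift ord0 ord0)).
  apply: (computable_rec (computable_proj ord0)
    (computable1_comp computable_succ (computable_proj (lift ord0 ord0)))).
  - by move=> u; rewrite !(tnth_nth 0).
  - by move=> j u; rewrite !(tnth_nth 0).
exists (OComp a (fun i => if i == ord0 then p else q)) => v /=.
exists [tuple f v; g v]; last by have := aP [tuple f v; g v]; rewrite !(tnth_nth 0).
by move=> [[|[|//]] lt_i]; rewrite (tnth_nth 0).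
Qed.

Lemma computable_linear a b : computable1_in X (fun m => a * m + b).
Proof.
apply: (@computable1_rec b (fun r => a + r)).
- by apply: computable_add; [exact: computable_const|exact: computable_proj].
- by rewrite muln0.
- by move=> j; rewrite mulnS addnA.
Qed.

Lemma computable_is_zero : computable1_in X (fun m => m == 0).
Proof.
apply: (@computable1_rec 1 (fun _ => 0)) => //; exact: computable_const.
Qed.

Lemma computable_odd : computable1_in X odd.
Proof.
apply: (@computable1_rec 0 (fun m => m == 0)) => //.
  exact: computable_is_zero.
by move=> j /=; case: odd.
Qed.

Lemma computable_mu n (f : n.+1.-tuple nat -> nat) (g : n.-tuple nat -> nat) :
  computable_in X f ->
  (forall v : n.-tuple nat, f [tuple of g v :: v] = 0) ->
  (forall (v : n.-tuple nat) j, j < g v -> 0 < f [tuple of j :: v]) ->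
  computable_in X g.
Proof.
move=> [p pf] fg0 fg; exists (OMu p) => v /=; split; first by rewrite -(fg0 v).
by move=> j /fg; exists (f [tuple of j :: v]).-1; rewrite prednK.
Qed.

End ComputableIn.

(** * Topology of sequence spaces *)

Lemma cvgn_coord (V : uniformType) (u : nat -> {ptws nat -> V})
    (x : {ptws nat -> V}) :
  (forall i, u n i @[n --> \oo] --> x i) -> u n @[n --> \oo] --> x.
Proof. by move=> ux; apply/pointwise_cvgP. Qed.

Lemma continuous_coord (T : topologicalType) (V : uniformType)
    (f : T -> {ptws nat -> V}) :
  (forall i, continuous (fun t => f t i)) -> continuous f.
Proof. by move=> cf t; apply/pointwise_cvgP => i; apply: cf. Qed.

Lemma cantor_coord_continuous i : continuous (fun y : cantor_space => y i).
Proof.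
move=> y; have /(@pointwise_cvgP nat bool (nbhs y) y _) := @cvg_id _ (nbhs y).
exact.
Qed.

(** Otherwise points outside [O] sharing ever longer prefixes with [y] would converge to [y]. *)
Lemma cantor_open_prefix (O : set cantor_space) y : open O -> O y ->
  exists N, forall y' : cantor_space, (forall n, n < N -> y' n = y n) -> O y'.
Proof.
move=> oO Oy; apply: contrapT => /forallNP noN.
have /choice[u uP] : forall N, exists y' : cantor_space,
    (forall n, n < N -> y' n = y n) /\ ~ O y'.
  by move=> N; have /existsNP[y' /not_implyP] := noN N; exists y'.
have : u n @[n --> \oo] --> y.
  apply: cvgn_coord => i; apply: cvg_near_cst; exists i.+1 => // n /= lt_in.
  by have [-> //] := uP n; lia.
have Oy' : nbhs y O by exact: open_nbhs_nbhs.
by move=> /(_ _ Oy')[N _ /(_ N (leqnn N))]; case: (uP N).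
Qed.

Lemma cvgn_nat_eventually (u : nat -> nat) l : u n @[n --> \oo] --> l ->
  exists N, forall n, N <= n -> u n = l.
Proof.
have nl : nbhs l [set l] by rewrite nbhs_principalE; exact/principal_filterP.
by move=> /(_ _ nl)[N _ NP]; exists N.
Qed.

(** * Conditions locking finitely many columns *)

Definition odd_part (y : cantor_space) : cantor_space := fun n => odd n && y n.

(* The column of n is the exponent of 2 in n + 1; column 0 consists of the even
   numbers. A condition (k, Y) fixes the values below k and the columns
   1, ..., k - 1 in full. *)
Definition locked k n := (n < k) || (0 < logn 2 n.+1 < k).

Definition agree k (Y y : cantor_space) := forall n, locked k n -> y n = Y n.

Lemma locked_mono k k' n : k <= k' -> locked k n -> locked k' n.
Proof. by rewrite /locked => le_k; lia. Qed.

Lemma agree_trans k k' Y Y' y :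
  k <= k' -> agree k Y Y' -> agree k' Y' y -> agree k Y y.
Proof.
move=> le_k YY' Y'y n lk; rewrite -(YY' _ lk); apply: Y'y.
exact: locked_mono lk.
Qed.

Lemma generic_exists k0 Y0 (D : nat -> cantor_space -> Prop) :
  (forall e k Y, k0 <= k -> agree k0 Y0 Y -> exists k' Y',
     [/\ k <= k', agree k Y Y' & forall y, agree k' Y' y -> D e y]) ->
  exists2 y, agree k0 Y0 y & forall e, D e y.
Proof.
move=> dense.
have [//||c c0 cP] := @invariant_choice (nat * cantor_space)
  (fun n c => k0 <= c.1 /\ agree k0 Y0 c.2)
  (fun n c c' => [/\ c.1 < c'.1, agree c.1 c.2 c'.2 &
                     forall y, agree c'.1 c'.2 y -> D n y]) (k0, Y0).
  move=> n [k Y] [/= le_k aY]; have [k' [Y' [le_k' aY' DY']]] := dense n k Y le_k aY.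
  (* The successor makes the levels strictly increase, so that every position is eventually
     locked. *)
  exists (k'.+1, Y') => /=.
    by split; [lia|exact: agree_trans aY'].
  split=> // y ay; apply: DY' => m lm; apply: ay; exact: locked_mono lm.
have chain m n : m <= n -> (c m).1 <= (c n).1 /\ agree (c m).1 (c m).2 (c n).2.
  elim: n => [|n IHn]; first by rewrite leqn0 => /eqP ->.
  rewrite leq_eqVlt => /predU1P[->//|/IHn[le_mn amn]].
  have [_ [lt_n an _]] := cP n; split; first lia.
  exact: agree_trans an.
have lt_c n : n <= (c n).1.
  by elim: n => // n IHn; have [_ [lt_n _ _]] := cP n; lia.
pose y : cantor_space := fun n => (c n.+1).2 n.
have ay n : agree (c n).1 (c n).2 y.
  move=> i li; rewrite /y; have [le_ni|lt_in] := leqP n i.+1.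
    exact: (chain _ _ le_ni).2.
  symmetry; apply: (chain _ _ (ltnW lt_in)).2.
  by rewrite /locked; have := lt_c i.+1; lia.
exists y; first by have := ay 0; rewrite c0.
by move=> e; have [_ [_ _]] := cP e; apply.
Qed.

(* An even position is never in a locked column, and changing it does not
   change the odd part. *)
Lemma diagonalize k Y (p : oprog 1) : exists k' Y',
  [/\ k <= k', agree k Y Y' & forall y, agree k' Y' y ->
    ~ forall n, oeval (char_fun (odd_part y)) p [tuple n] (char_fun y n)].
Proof.
(* An even position not below [k], hence not locked. *)
pose n := k.*2.
have [[y [b [ay yb]]]|no] := pselect (exists y b, agree k Y y /\
    oeval (char_fun (odd_part y)) p [tuple n] b); last first.
  by exists k, Y; split=> // y ay /(_ n) pn; apply: no; exists y, (char_fun y n).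
have [N NP] := oeval_use yb.
(* The bit [b == 0] differs from the output [b], even if [b] exceeds 1. The new level locks it
   together with the use [N] of the computation. *)
pose Y' : cantor_space := fun i => if i == n then b == 0 else y i.
exists (maxn (maxn k N) n.+1), Y'; split; first lia.
  move=> i li; rewrite /Y'; case: eqP => [ein|_]; last exact: ay.
  move: li; rewrite /locked ein lognE /= dvdn2 /= odd_double /=.
  by rewrite /n; lia.
move=> y' ay' /(_ n).
have /NP pb : forall i, i < N -> char_fun (odd_part y') i = char_fun (odd_part y) i.
  move=> i ltiN; rewrite /char_fun /odd_part (ay' i) /Y'; last by rewrite /locked; lia.
  by case: eqP => // ->; rewrite odd_double.
move/(oeval_fun pb); rewrite /char_fun (ay' n) /Y'; last by rewrite /locked; lia.
by rewrite eqxx; case: (b).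
Qed.

(** * Coding a sequence into a column *)

Definition column_pos k m := (2 ^ k) * m.*2.+1 - 1.

Lemma column_posS k m : (column_pos k m).+1 = 2 ^ k * m.*2.+1.
Proof. by rewrite /column_pos subn1 prednK// muln_gt0 expn_gt0. Qed.

Lemma logn_column_pos k m : logn 2 (column_pos k m).+1 = k.
Proof.
rewrite column_posS lognM ?expn_gt0// pfactorK// lognE /= dvdn2 /= odd_double.
by rewrite addn0.
Qed.

Lemma ltn_column_pos k m m' : (column_pos k m < column_pos k m') = (m < m').
Proof. by rewrite -ltnS !column_posS ltn_pmul2l ?expn_gt0// ltnS ltn_double. Qed.

Lemma leq_column_pos k m : m <= column_pos k m.
Proof.
rewrite -ltnS column_posS; have : 0 < 2 ^ k by rewrite expn_gt0.
by nia.
Qed.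

Lemma odd_column_pos k m : 0 < k -> odd (column_pos k m).
Proof.
case: k => // k _; have := column_posS k.+1 m; rewrite expnS => /(congr1 odd).
by rewrite -mulnA oddM /= => /negbFE.
Qed.

(** This keeps all of column [k] free at level [k]. It fails for [k = 1], since
    [column_pos 1 0 = 1]. *)
Lemma gtn_column_pos k m : 1 < k -> k < column_pos k m.
Proof.
move=> k1; rewrite -ltnS column_posS.
suff : k.+1 < 2 ^ k by nia.
by elim: k k1 => // -[//|[//|k]] IHk _; rewrite expnS; have := IHk isT; lia.
Qed.

(** Column [k] survives in the odd part and lists the range of [m]. Searching through it yields
    [m 0], [m 1], ... in turn, and their parities are the bits of [y]. *)
Lemma column_decodes k (y : cantor_space) (m : nat -> nat) : 0 < k ->
  (forall j, m j < m j.+1) ->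
  (forall i, y (column_pos k i) = true <-> exists j, i = m j) ->
  (forall j, odd (m j) = y j) ->
  turing_le y (odd_part y).
Proof.
move=> k0 mS ym oddm; set X := char_fun (odd_part y).
have Xpos i : X (column_pos k i) = y (column_pos k i).
  by rewrite /X /char_fun /odd_part odd_column_pos.
have m_inj : {homo m : i j / i < j}.
  by apply: homo_ltn mS => ? ? ?; apply: ltn_trans.
have next t : exists i, y (column_pos k (i + t)).
  have le_m j : j <= m j by elim: j => // j IHj; have := mS j; lia.
  exists (m t - t); rewrite subnK//; apply/ym; by exists t.
pose h t := ex_minn (next t).
have ch : computable1_in X h.
  apply: (@computable_mu X 1 (fun v : 2.-tuple nat =>
    X (column_pos k (tnth v ord0 + tnth v (lift ord0 ord0))) == 0)).
  - apply: computable1_comp (computable_is_zero X) _.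
    apply: computable1_comp (computable_oracle X) _.
    have -> : column_pos k = fun i => 2 ^ k.+1 * i + (2 ^ k - 1).
      apply: funext => i; apply: succn_inj.
      rewrite column_posS expnS; have : 0 < 2 ^ k by rewrite expn_gt0.
      by nia.
    apply: computable1_comp (computable_linear X _ _) _.
    by apply: computable_add; exact: computable_proj.
  - move=> v; rewrite !(tnth_nth 0) /= Xpos /h.
    case: ex_minnP => i; case/tupleP: v => t u; rewrite theadE /=.
    by move=> ->.
  - move=> v j; rewrite !(tnth_nth 0) /= Xpos /h; case/tupleP: v => t u.
    rewrite theadE /=; case: ex_minnP => i _ min_i lt_ji.
    have := min_i j; case: (y _) => // /(_ isT); lia.
(* The search for [m j] starts at [f j]: at 0, then one past the preceding element. *)
pose f := fix f j := if j is j'.+1 then (h (f j') + f j').+1 else 0.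
have le_m i j : i <= j -> m i <= m j.
  by rewrite leq_eqVlt => /predU1P[->//|/m_inj/ltnW].
have fS j : f j.+1 = (m j).+1.
  elim: j => [|j IHj] /=; rewrite -/(f _) /h; case: ex_minnP => i.
    move=> /ym[j im] min_i; have := min_i (m 0); rewrite addn0.
    have /ym -> : exists i, m 0 = m i by exists 0.
    by have := le_m 0 j (leq0n j); lia.
  rewrite -/(f j.+1) IHj => /ym[j' im] min_i.
  have lt_j : j < j' by rewrite ltnNge; apply/negP => /le_m; lia.
  have := min_i (m j.+1 - (m j).+1); rewrite subnK//.
  have /ym -> : exists i, m j.+1 = m i by exists j.+1.
  have := le_m _ _ lt_j; have := mS j; lia.
have cf : computable1_in X f.
  apply: (@computable1_rec X 0 (fun t => (h t + t).+1)) => //.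
  apply: computable1_comp (computable_succ X) _.
  by apply: computable_add; [exact: ch|exact: computable_proj].
(* As [f j.+1] is the successor of [m j], its parity has to be negated. *)
have [p pP] : computable1_in X (fun j => (odd (f j.+1) : nat) == 0).
  apply: computable1_comp (computable_is_zero X) _.
  apply: computable1_comp (computable_odd X) _.
  apply: computable1_comp cf _; exact: computable_succ.
exists p => n; have := pP [tuple n].
by rewrite theadE fS /= oddm /char_fun; case: (y n).
Qed.

(* If no extension of (k, Y) forces membership in some F j, then column k,
   still free, can be made to list a set whose elements m_0 < m_1 < ... satisfy
   odd m_j = y j, while y is kept outside of every F j. *)
Lemma force_closed k Y (F : nat -> set cantor_space) : 1 < k ->
  (forall j, closed (F j)) ->
  (forall y, agree k Y y -> turing_le y (odd_part y) -> exists j, F j y) ->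
  exists k' Y',
    [/\ k <= k', agree k Y Y' & exists j, forall y, agree k' Y' y -> F j y].
Proof.
move=> k1 cF decF; apply: contrapT => /forallNP no.
have avoid k' Y' j : k <= k' -> agree k Y Y' -> exists y, agree k' Y' y /\ ~ F j y.
  move=> le_k aY'; have /forallNP/(_ Y') := no k'; apply: contra_notP.
  move=> /forallNP all_F; split=> //; exists j => y ay; apply: contrapT => nF.
  exact: (all_F y).
have pos_free i : ~~ locked k (column_pos k i).
  by rewrite /locked logn_column_pos; have := gtn_column_pos i k1; lia.
(* In a stage [c], column [k] is empty from [c.1] on. Step [j] fixes a prefix that avoids [F j] and
   adds a single element to column [k], whose parity is bit [j]. *)
pose I j (c : nat * cantor_space) := [/\ k < c.1, j < c.1, agree k Y c.2 &
  forall i, c.1 <= column_pos k i -> c.2 (column_pos k i) = false].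
pose R j (c c' : nat * cantor_space) := [/\ c.1 < c'.1,
  forall n, n < c.1 -> c'.2 n = c.2 n,
  forall y : cantor_space, (forall n, n < c'.1 -> y n = c'.2 n) -> ~ F j y &
  exists m, [/\ c.1 <= column_pos k m < c'.1, odd m = c'.2 j &
    forall i, c.1 <= column_pos k i -> c'.2 (column_pos k i) = (i == m)]].
(* Column [k] is cleared, and the level [k.+1] locks it in this state. *)
pose Y0 : cantor_space := fun n => ((n < k) || (logn 2 n.+1 != k)) && Y n.
have [||c c0 cP] := @invariant_choice _ I R (k.+1, Y0).
- split=> //=.
  + move=> n ln; rewrite /Y0; suff -> : (n < k) || (logn 2 n.+1 != k) by [].
    by move: ln; rewrite /locked; lia.
  + move=> i lt_ki; rewrite /Y0 logn_column_pos eqxx /=.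
    by have := gtn_column_pos i k1; lia.
- move=> j [K Z] [/= lt_kK lt_jK aZ Z0].
  (* As [k < K], the column [k] of [y] is that of [Z], thus empty from [K] on. An element can be
     inserted beyond the prefix that keeps [y] outside of [F j]. *)
  have [y [ay nFy]] := avoid K Z j (ltnW lt_kK) aZ.
  have [N NP] := cantor_open_prefix (closed_openC (cF j)) nFy.
  (* The last summand, 0 or 1, corrects the parity. *)
  pose m := N + K + (odd (N + K) (+) y j).
  have oddm : odd m = y j by rewrite /m oddD oddb; case: odd; case: (y j).
  have le_m : N + K <= column_pos k m.
    by apply: leq_trans (leq_column_pos k m); rewrite /m; lia.
  pose Z' : cantor_space := fun n => (n == column_pos k m) || y n.
  have Z'm i : K <= column_pos k i -> Z' (column_pos k i) = (i == m).
    move=> le_Ki; rewrite /Z' ay; last by rewrite /locked logn_column_pos; lia.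
    rewrite Z0// orbF; apply/eqP/eqP => [|->//] eq_pos.
    by case: (ltngtP i m) => //; rewrite -(ltn_column_pos k) eq_pos ltnn.
  exists ((column_pos k m).+1, Z'); split=> //=; first lia.
  + lia.
  + move=> n ln; rewrite /Z'; case: eqP ln => [->|_ ln].
      by rewrite (negPf (pos_free m)).
    exact: agree_trans (ltnW lt_kK) aZ ay _ ln.
  + move=> i lt_mi; rewrite Z'm; last lia.
    by apply/eqP => eq_im; move: lt_mi; rewrite eq_im ltnn.
  + lia.
  + move=> n lt_nK; rewrite /Z' ay; last by rewrite /locked lt_nK.
    by case: eqP => //; lia.
  + move=> y' y'P; apply: NP => n lt_nN; rewrite y'P; last lia.
    by rewrite /Z'; case: eqP => //; lia.
  + exists m; split=> //; first lia.
    by rewrite oddm /Z'; case: eqP => //; lia.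
have cS j : (c j).1 < (c j.+1).1 by have [_ []] := cP j.
have c_mono i j : i <= j -> (c i).1 <= (c j).1.
  elim: j => [|j IHj]; first by rewrite leqn0 => /eqP ->.
  by rewrite leq_eqVlt => /predU1P[->//|/IHj]; have := cS j; lia.
have chain i j n : i <= j -> n < (c i).1 -> (c j).2 n = (c i).2 n.
  move=> + lt_n; elim: j => [|j IHj]; first by rewrite leqn0 => /eqP ->.
  rewrite leq_eqVlt => /predU1P[->//|le_ij]; rewrite -(IHj le_ij).
  have [_ [_ + _ _]] := cP j; apply; exact: leq_trans lt_n (c_mono i j le_ij).
have c_gt n : n < (c n).1 by have [[]] := cP n.
pose y : cantor_space := fun n => (c n).2 n.
have y_c j n : n < (c j).1 -> y n = (c j).2 n.
  by move=> lt_n; rewrite /y; have [/chain->|/ltnW/chain->] := leqP j n.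
have ay : agree k Y y by move=> n; have [[_ _ + _] _] := cP n; apply.
have /choice[m mP] : forall j, exists m, [/\ (c j).1 <= column_pos k m < (c j.+1).1,
    odd m = y j & forall i, (c j).1 <= column_pos k i < (c j.+1).1 ->
      y (column_pos k i) = (i == m)].
  move=> j; have [_ [_ _ _ [m [m_c oddm mi]]]] := cP j; exists m; split=> //.
    by rewrite oddm (y_c j.+1)//; have := cS j; have := c_gt j; lia.
  by move=> i /andP[le_i lt_i]; rewrite (y_c j.+1)// mi.
have [|j] := decF y ay; last first.
- have [_ [_ _ + _]] := cP j; apply=> n; exact: y_c.
apply: (@column_decodes k y m); first lia.
- by move=> j; rewrite -(ltn_column_pos k); have [] := mP j; have [] := mP j.+1; lia.
- move=> i; split=> [yi|[j ->]]; last first.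
    by have [m_c _ ->] := mP j; rewrite ?eqxx.
  have : exists n, column_pos k i < (c n).1 by exists (column_pos k i).
  move=> /ex_minnP[[|j] lt_i min_j].
    by move: lt_i; rewrite c0 /=; have := gtn_column_pos i k1; lia.
  exists j; have [_ _ mi] := mP j; apply/eqP; rewrite -mi// lt_i andbT leqNgt.
  by apply/negP => /min_j; rewrite ltnn.
- by move=> j; have [] := mP j.
Qed.

(** Level 2 ensures the bound [1 < k] of [force_closed] and lets [Y0] prescribe column 1. *)
Lemma reduces_to_odd_part_not_Pi03 Y0 (F : nat -> nat -> set cantor_space) :
  (forall i j, closed (F i j)) ->
  ~ forall y, agree 2 Y0 y ->
      (turing_le y (odd_part y) <-> forall i, exists j, F i j y).
Proof.
move=> cF FP.
pose P e : oprog 1 := decode_oprog (odflt (GenTree.Leaf 0) (unpickle e)) 1.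
have [|y ay yP] := @generic_exists 2 Y0 (fun e y =>
  (~ forall n, oeval (char_fun (odd_part y)) (P e) [tuple n] (char_fun y n)) /\
  exists j, F e j y).
- move=> e k Y le_2k aY.
  have [k1 [Y1 [le_k1 aY1 Y1P]]] := diagonalize k Y (P e).
  have [|||k2 [Y2 [le_k2 aY2 [j jP]]]] := @force_closed k1 Y1 (F e).
  + exact: leq_trans le_k1.
  + exact: cF.
  + move=> y ay /FP; apply.
    exact: agree_trans le_2k aY (agree_trans le_k1 aY1 ay).
  exists k2, Y2; split.
  + exact: leq_trans le_k2.
  + exact: agree_trans aY2.
  + move=> y ay; split; last by exists j; apply: jP.
    exact/Y1P/(agree_trans le_k2 aY2).
have /(FP _ ay)[p pP] : forall i, exists j, F i j y by move=> i; have [] := yP i.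
have [t tp] := decode_oprog_surj p.
have [] := yP (pickle t); rewrite /P pickleK /= tp; exact.
Qed.

Lemma odd_part_turing_le y : turing_le (odd_part y) y.
Proof.
(* A conjunction: the sum of two negated bits is 0 iff both bits are 1. *)
have [p pP] : computable1_in (char_fun y)
    (fun n => ((odd n : nat) == 0 : nat) + (char_fun y n == 0) == 0).
  apply: computable1_comp (computable_is_zero _) _; apply: computable_add.
    apply: computable1_comp (computable_is_zero _) _; exact: computable_odd.
  apply: computable1_comp (computable_is_zero _) _; exact: computable_oracle.
exists p => n; have := pP [tuple n]; rewrite theadE /char_fun /odd_part.
by case: odd; case: (y n).
Qed.

Lemma odd_part_continuous : continuous odd_part.
Proof.
apply: continuous_coord => i y; rewrite /odd_part; case: odd => /=.
  exact: cantor_coord_continuous.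
exact: cvg_cst.
Qed.

(** * Learnability *)

Definition padded (s : seq bool) : cantor_space := nth false s.

(** Column 1, locked at level 2, diagonalizes: its entry [e] defeats the pair of a program and a
    finite sequence coded by [e]. *)
Lemma avoid_padded : exists Y0, forall y, agree 2 Y0 y ->
  forall s, ~ turing_le (odd_part y) (padded s).
Proof.
pose c e := odflt (GenTree.Leaf 0, [::])
  (unpickle e : option (GenTree.tree nat * seq bool)).
pose halts1 n := oeval (char_fun (padded (c (n %/ 4)).2))
  (decode_oprog (c (n %/ 4)).1 1) [tuple n] 1.
exists (fun n => ~~ `[< halts1 n >]) => y ay s [p pP].
have [t tp] := decode_oprog_surj p.
pose e := pickle (t, s); pose n := column_pos 1 e.
(* Here [column_pos 1 e] is [4 * e + 1]. *)
have ne : n %/ 4 = e by rewrite /n /column_pos; lia.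
have := pP n; rewrite /char_fun /odd_part odd_column_pos//= ay; last first.
  by rewrite /locked logn_column_pos orbT.
have h1 : halts1 n = oeval (char_fun (padded s)) p [tuple n] 1.
  by rewrite /halts1 ne /c /e pickleK /= tp.
by case: asboolP => h; rewrite h1 in h => //= /(oeval_fun h).
Qed.

Definition scons (y : cantor_space) (xs : nat -> cantor_space) :
    {ptws nat -> cantor_space} := fun n => if n is m.+1 then xs m else y.

Definition starts_with (s : seq (seq bool)) (xs : nat -> cantor_space) :=
  forall i, i < size s -> xs i = padded (nth [::] s i).

Lemma scons_continuous xs : continuous (scons ^~ xs).
Proof.
apply: continuous_coord => -[|i] y /=; first exact: cvg_id.
exact: cvg_cst.
Qed.

(** Otherwise some [xs'] agreeing with [xs] on ever larger squares would converge to [xs] while the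
    discrete value of [l] differs. *)
Lemma learner_box (l : {ptws nat -> cantor_space} * cantor_space -> nat) y x
    (xs : nat -> cantor_space) :
  continuous l -> exists d, forall xs' : nat -> cantor_space,
    (forall i m, i < d -> m < d -> xs' i m = xs i m) ->
    l (scons y xs', x) = l (scons y xs, x).
Proof.
move=> cl; apply: contrapT => /forallNP noN.
have /choice[u uP] : forall d, exists xs' : nat -> cantor_space,
    (forall i m, i < d -> m < d -> xs' i m = xs i m) /\
    l (scons y xs', x) <> l (scons y xs, x).
  by move=> d; have /existsNP[xs' /not_implyP] := noN d; exists xs'.
have cvg_u : (scons y (u d), x) @[d --> \oo] --> (scons y xs, x).
  apply: (@cvg_pair _ _ _ _ (nbhs (scons y xs)) (nbhs x)); last exact: cvg_cst.
  apply: cvgn_coord => -[|i] /=; first exact: cvg_cst.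
  apply: cvgn_coord => m; apply: cvg_near_cst.
  exists (maxn i m).+1 => // d /= lt_d.
  by have [-> //] := uP d; lia.
have cvg_lu : l (scons y (u d), x) @[d --> \oo] --> l (scons y xs, x).
  by apply: continuous_cvg cvg_u; exact: cl.
have [N /(_ N (leqnn N))] := cvgn_nat_eventually cvg_lu.
by case: (uP N).
Qed.

Lemma not_learnable_turing_equiv : ~ learnable turing_equiv.
Proof.
move=> [l [cl lP]]; have [Y0 Y0P] := avoid_padded.
pose U i : seq (seq bool) := odflt [::] (unpickle i).
pose V j : seq (seq bool) * nat := odflt ([::], 0) (unpickle j).
(* Entry 0 of [scons y xs] is [y], so the value 0 is a guess for [y]. *)
pose F i j : set cantor_space := \bigcap_(a in
    [set a : (nat -> cantor_space) * nat |
       starts_with (U i ++ (V j).1) a.1 /\ (V j).2 <= a.2])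
  [set y | l a.2 (scons y a.1, odd_part y) = 0].
apply: (@reduces_to_odd_part_not_Pi03 Y0 F).
  move=> i j; apply: closed_bigI => -[xs n] _ /=.
  apply: (@preimage_closed _ _ (fun y => l n (scons y xs, odd_part y)) [set 0]);
    last exact: discrete_closed.
  move=> y _.
  have cvg_y : (scons z xs, odd_part z) @[z --> y] --> (scons y xs, odd_part y).
    apply: (@cvg_pair _ _ _ _ (nbhs (scons y xs)) (nbhs (odd_part y))).
      exact: scons_continuous.
    exact: odd_part_continuous.
  by apply: continuous_cvg cvg_y; exact: cl.
move=> y ay; split=> [y_le i|FP]; last first.
  have [j Fj] := FP (pickle ([::] : seq (seq bool))).
  move: Fj; rewrite /F /U pickleK /=; move: (V j) => [s N] /= Fj.
  (* Repeating [odd_part y] after [s] forces the learner to converge; by [Fj] its limit is 0, which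
     points to [y]. *)
  pose xs i := if i < size s then padded (nth [::] s i) else odd_part y.
  have s_xs : starts_with s xs by rewrite /starts_with /xs => i ->.
  have [|L [/cvgn_nat_eventually[N' N'P]]] := lP (scons y xs) (odd_part y).
    by exists (size s).+1; rewrite /= /xs ltnn; split; exists (OOracle) => n.
  have := N'P (maxn N N') (leq_maxr _ _).
  rewrite (Fj (xs, maxn N N')) => [<- []//|].
  by split=> //=; exact: leq_maxl.
apply: contrapT => /forallNP noV.
have step s j : exists s' n, [/\ 0 < size s', j <= n &
    forall xs, starts_with (U i ++ s ++ s') xs ->
      l n (scons y xs, odd_part y) <> 0].
  have /existsNP[[xs n] /not_implyP[[/= s_xs le_jn] ln]] := noV (pickle (s, j)).
  rewrite /V pickleK /= in s_xs le_jn.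
  have [d dP] := learner_box y (odd_part y) xs (cl n).
  pose b := size (U i ++ s).
  (* Truncating to [d] bits preserves the square given by [dP]; [d.+1] entries keep [s'] nonempty if
     [d = 0]. *)
  pose s' := mkseq (fun m => mkseq (xs (b + m)) d) d.+1.
  exists s', n; split=> // xs' s'_xs.
  rewrite dP // => i' m lt_i lt_m.
  have sz : i' < size ((U i ++ s) ++ s').
    by rewrite size_cat size_mkseq; lia.
  rewrite s'_xs catA// nth_cat -/b; case: ifPn => [lt_b|].
    by rewrite s_xs.
  rewrite -leqNgt => le_b; rewrite nth_mkseq; last lia.
  by rewrite /padded nth_mkseq// subnKC.
have [//|j s _|c _ cP] := @invariant_choice (seq (seq bool)) (fun _ _ => True)
  (fun j s s' => exists t n, [/\ s' = s ++ t, 0 < size t, j <= n &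
    forall xs, starts_with (U i ++ s') xs ->
      l n (scons y xs, odd_part y) <> 0]) [::].
  by have [t [n [t0 le_jn tP]]] := step s j; exists (s ++ t) => //; exists t, n.
have chain m n : m <= n -> exists t, c n = c m ++ t.
  elim: n => [|n IHn]; first by rewrite leqn0 => /eqP ->; exists [::]; rewrite cats0.
  rewrite leq_eqVlt => /predU1P[->|/IHn[t ct]]; first by exists [::]; rewrite cats0.
  by have [_ [t' [_ [-> _ _ _]]]] := cP n; exists (t ++ t'); rewrite ct catA.
have size_c n : n <= size (c n).
  elim: n => // n IHn; have [_ [t [_ [-> t0 _ _]]]] := cP n.
  by rewrite size_cat; lia.
pose xs m := padded (nth [::] (U i ++ c m.+1) m).
have c_xs n : starts_with (U i ++ c n) xs.
  move=> m lt_m; rewrite /xs; congr padded.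
  have [/chain[t ->]|/ltnW/chain[t ct]] := leqP n m.+1.
    by rewrite catA nth_cat lt_m.
  rewrite ct [in RHS]catA [in RHS]nth_cat size_cat.
  by have -> : m < size (U i) + size (c m.+1) by have := size_c m.+1; lia.
(* Entry 0 is equivalent to [odd_part y], so a limit [L] exists. It is not 0 by construction, hence
   it points to an eventually zero sequence, against [Y0P]. *)
have [|L [/cvgn_nat_eventually[N NP]]] := lP (scons y xs) (odd_part y).
  by exists 0; split=> //; exact: odd_part_turing_le.
have [_ [_ [n [_ _ /NP ln /(_ _ (c_xs N.+1))]]]] := cP N.
rewrite ln; case: L {NP ln} => // L _ [/= le_xs _].
exact: Y0P le_xs.
Qed.

Theorem theorem4p1 :
  ~ learnable turing_equiv /\
  ~ Pi0 3 [set xy : cantor_space * cantor_space | turing_equiv xy.1 xy.2].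
Proof.
split; first exact: not_learnable_turing_equiv.
move=> [F F2 EF].
(* Taking complements twice turns the relation into the intersection over [i] of the unions over [j]
   of closed sets [G i j]. *)
have /choice[G GP] : forall i, exists G : nat -> set (cantor_space * cantor_space),
    (forall j, open (~` G j)) /\ ~` F i = \bigcup_j G j.
  by move=> i; have [G] := F2 i; exists G.
apply: (@reduces_to_odd_part_not_Pi03 point
  (fun i j => [set y | G i j (odd_part y, y)])).
  move=> i j; apply: (@preimage_closed _ _ (fun y => (odd_part y, y))); last first.
    by rewrite -(setCK (G i j)); apply: open_closedC; have [] := GP i.
  move=> y _; apply: (@cvg_pair _ _ _ _ (nbhs (odd_part y)) (nbhs y)).
    exact: odd_part_continuous.
  exact: cvg_id.
move=> y _.
have equivE : turing_equiv (odd_part y) y <-> turing_le y (odd_part y).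
  by split=> [[]//|le_y]; split=> //; exact: odd_part_turing_le.
rewrite -equivE; split=> [Ey i|GPy].
  have : (~` F i) (odd_part y, y).
    move=> Fi; have : (\bigcup_i F i) (odd_part y, y) by exists i.
    by rewrite -EF; apply.
  by have [_ ->] := GP i; move=> [j _ Gj]; exists j.
apply: contrapT => nE.
have : (\bigcup_i F i) (odd_part y, y) by rewrite -EF.
move=> [i _]; apply: contrapT => /=; rewrite notK.
have [j Gj] := GPy i.
have : (\bigcup_j G i j) (odd_part y, y) by exists j.
by have [_ <-] := GP i.
Qed.
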